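(* Let $W\in\mathbb{R}^{m\times n}$ have full row rank and let $\{(\mathbf{u}^k,\mathbf{y}^k)\}$ be the sequence generated by Algorithm A (described in the context), assumed to be bounded. Let $t=\max_k\{t_k\}$, $\rho\ge\max\{t,1\}$, and suppose that for some constant $c>0$ and all $k$ $$\begin{aligned}t_k\ge\max\Big\{&4\Big(\|W^{\top}(W^{\top})^{\dagger}(A^{\top}A+\beta W^{\top}W)\|+\|W^{\top}W\|\,\|W^{\dagger}\|^2\,\|A^{\top}A+\beta W^{\top}W\|\\&+\big(\|A^{\top}A+\beta W^{\top}W\|+1\big)\|W^{\dagger}\|^2\,\|A^{\top}A+\beta W^{\top}W\|\Big),\ c\Big\}.\end{aligned}$$ Then the sequence $\{(\mathbf{u}^k,\mathbf{y}^k)\}$ converges at least linearly to a limiting critical point $(\mathbf{u}^*,\mathbf{y}^* )$ of $h$, i.e., there exist constants $c_1>0$ and $\tau\in[0,1)$ such that $$\|(\mathbf{u}^k,\mathbf{y}^k)-(\mathbf{u}^*,\mathbf{y}^* )\|\le c_1\tau^k\quad\text{for }k=0,1,\dots$$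
   Context: Data: $A\in\mathbb{R}^{p\times n}$, $\mathbf{u}_0\in\mathbb{R}^p$, $f(\mathbf{u})=\frac12\|A\mathbf{u}-\mathbf{u}_0\|^2$, constants $\lambda,\beta,\rho>0$ and $t_k>0$. $\|\cdot\|$ is the Euclidean norm of vectors and the spectral norm of matrices, $\|\mathbf{y}\|_0$ is the number of nonzero entries of $\mathbf{y}$, and $\dagger$ denotes the Moore–Penrose pseudoinverse. Define $$\mathbf{z}(\mathbf{u})=(W^{\top})^{\dagger}(-\nabla f(\mathbf{u})-\beta W^{\top}W\mathbf{u}),$$ $$h(\mathbf{u},\mathbf{y})=f(\mathbf{u})+\langle W\mathbf{u}-\mathbf{y},\mathbf{z}(\mathbf{u})\rangle+\lambda\|\mathbf{y}\|_0+\tfrac{\beta}{2}\|W\mathbf{u}\|^2+\tfrac{\rho}{2}\|W\mathbf{u}-\mathbf{y}\|^2 .$$ Algorithm A: choose $\mathbf{u}^0\in\mathbb{R}^n$, set $\mathbf{y}^0=W\mathbf{u}^0$, $\mathbf{z}^0=\mathbf{z}(\mathbf{u}^0)$. For $k=0,1,2,\dots$: (1) $\mathbf{u}^{k+1}=\operatorname{argmin}_{\mathbf{u}\in\mathbb{R}^n}\{f(\mathbf{u})+\langle W\mathbf{u}-\mathbf{y}^k,\mathbf{z}^k\rangle+\frac{\beta}{2}\|W\mathbf{u}\|^2+\frac{t_k}{2}\|\mathbf{u}-\mathbf{u}^k\|^2+\frac{\rho}{2}\|W\mathbf{u}-\mathbf{y}^k\|^2\}$; (2) $\mathbf{z}^{k+1}=\mathbf{z}(\mathbf{u}^{k+1})$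 and $\mathbf{y}^{k+1}\in\operatorname{argmin}_{\mathbf{y}\in\mathbb{R}^m}\{\lambda\|\mathbf{y}\|_0+\langle W\mathbf{u}^{k+1}-\mathbf{y},\mathbf{z}^{k+1}\rangle+\frac{t_k}{2}\|\mathbf{y}-\mathbf{y}^k\|^2+\frac{\rho}{2}\|W\mathbf{u}^{k+1}-\mathbf{y}\|^2\}$. Subdifferential: the regular subdifferential $\widehat\partial g(\mathbf{x})$ is the set of $\mathbf{v}$ with $\liminf_{\mathbf{x}'\to\mathbf{x},\,\mathbf{x}'\ne\mathbf{x}}\frac{g(\mathbf{x}')-g(\mathbf{x})-\langle\mathbf{v},\mathbf{x}'-\mathbf{x}\rangle}{\|\mathbf{x}'-\mathbf{x}\|}\ge0$; the (limiting) subdifferential $\partial g(\mathbf{x})$ is the set of $\mathbf{v}$ for which there are $\mathbf{x}^j\to\mathbf{x}$ with $g(\mathbf{x}^j)\to g(\mathbf{x})$ and $\mathbf{v}^j\in\widehat\partial g(\mathbf{x}^j)$ with $\mathbf{v}^j\to\mathbf{v}$. A (limiting) critical point of $h$ is a point with $\mathbf{0}\in\partial h$. *)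

(* Defs.v *)
From HB Require Import structures.
From mathcomp Require Import all_boot all_order all_algebra.
From mathcomp Require Import all_classical all_reals all_analysis.

Set Implicit Arguments.
Unset Strict Implicit.
Unset Printing Implicit Defensive.

Import Order.TTheory GRing.Theory Num.Theory.
Import numFieldNormedType.Exports.
Local Open Scope classical_set_scope.
Local Open Scope ring_scope.

Definition dotv {R : realType} {d : nat} (x y : 'cV[R]_d) : R :=
  \sum_(i < d) x i 0 * y i 0.

(* The library norm `|x| on matrices is the max norm, hence a separate
   Euclidean norm; both induce the matrix topology used in [cvg] below. *)
Definition enorm {R : realType} {d : nat} (x : 'cV[R]_d) : R :=
  Num.sqrt (dotv x x).

Definition specnorm {R : realType} {p q : nat} (M : 'M[R]_(p, q)) : R :=
  sup [set enorm (M *m v) | v in [set v : 'cV[R]_q | enorm v <= 1]].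

Definition norm0 {R : realType} {d : nat} (y : 'cV[R]_d) : R :=
  #|[set i : 'I_d | y i 0 != 0]|%:R.

Definition grad {R : realType} {d : nat} (g : 'cV[R]_d -> R) (x : 'cV[R]_d) :
    'cV[R]_d :=
  \col_(i < d) 'D_(delta_mx i 0) (g : 'cV[R]_d -> R^o) x.

(* The four Penrose equations. *)
Definition penrose {R : realType} {p q : nat}
    (M : 'M[R]_(p, q)) (X : 'M[R]_(q, p)) : Prop :=
  [/\ M *m X *m M = M, X *m M *m X = X,
      (M *m X)^T = M *m X & (X *m M)^T = X *m M].

Definition pinv {R : realType} {p q : nat} (M : 'M[R]_(p, q)) : 'M[R]_(q, p) :=
  xget 0 [set X | penrose M X].

Lemma gram_unitmx {R : realType} {p q : nat} (B : 'M[R]_(p, q)) :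
  row_free B -> B *m B^T \in unitmx.
Proof.
move=> Bfree; rewrite -row_free_unit; apply: inj_row_free => v vBB0.
apply: (row_free_inj Bfree); rewrite mul0mx.
have : v *m B *m (v *m B)^T = 0.
  by rewrite trmx_mul mulmxA -(mulmxA v) vBB0 mul0mx.
move: (v *m B) => w /matrixP/(_ 0 0); rewrite !mxE => /eqP.
rewrite psumr_eq0 => [/allP w0|i _]; last by rewrite mxE -expr2 sqr_ge0.
apply/rowP => i; rewrite mxE; apply/eqP.
by have := w0 i (mem_index_enum _); rewrite /= mxE mulf_eq0 orbb.
Qed.

Lemma penrose_rank_factorization {R : realType} {p r q : nat}
    (C : 'M[R]_(p, r)) (B : 'M[R]_(r, q)) :
  row_free C^T -> row_free B ->
  penrose (C *m B)
    (B^T *m invmx (B *m B^T) *m (invmx (C^T *m C) *m C^T)).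
Proof.
move=> Cfull Bfree; have uB := gram_unitmx Bfree.
have uC : C^T *m C \in unitmx by rewrite -{2}[C]trmxK gram_unitmx.
set G := invmx (B *m B^T); set H := invmx (C^T *m C).
have GT : G^T = G by rewrite /G trmx_inv trmx_mul trmxK.
have HT : H^T = H by rewrite /H trmx_inv trmx_mul trmxK.
have BG : B *m (B^T *m G) = 1%:M by rewrite mulmxA mulmxV.
have HC : H *m C^T *m C = 1%:M by rewrite -mulmxA mulVmx.
have E1 : C *m B *m (B^T *m G *m (H *m C^T)) = C *m (H *m C^T).
  by rewrite -mulmxA (mulmxA B) BG mul1mx.
have E2 : B^T *m G *m (H *m C^T) *m (C *m B) = B^T *m G *m B.
  by rewrite -mulmxA (mulmxA (H *m C^T)) HC mul1mx.
split.
- by rewrite E1 -mulmxA (mulmxA (H *m C^T)) HC mul1mx.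
- by rewrite E2 -mulmxA (mulmxA B) BG mul1mx.
- by rewrite E1 !trmx_mul trmxK HT mulmxA.
- by rewrite E2 !trmx_mul trmxK GT mulmxA.
Qed.

Lemma pinvP {R : realType} {p q : nat} (M : 'M[R]_(p, q)) : penrose M (pinv M).
Proof.
suff [X MX] : exists X, penrose M X by rewrite /pinv; case: xgetP => // /(_ X).
have Cfull : row_free (col_base M)^T.
  by rewrite /row_free mxrank_tr; exact: col_base_full.
have := penrose_rank_factorization Cfull (row_base_free M).
by rewrite mulmx_base => MX; exact: ex_intro MX.
Qed.

Lemma penrose_unique {R : realType} {p q : nat} (M : 'M[R]_(p, q))
  (X Y : 'M[R]_(q, p)) : penrose M X -> penrose M Y -> X = Y.
Proof.
case=> X1 X2 X3 X4 [Y1 Y2 Y3 Y4].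
have MXY : M *m X = M *m Y.
  by rewrite -X3 -{1}Y1 -(mulmxA (M *m Y)) trmx_mul X3 Y3 mulmxA X1.
have XYM : X *m M = Y *m M.
  by rewrite -X4 -{1}Y1 -(mulmxA M) mulmxA trmx_mul X4 Y4 -mulmxA (mulmxA M) X1.
by rewrite -X2 XYM -mulmxA MXY mulmxA.
Qed.

Definition is_argmin {R : realType} {d : nat} (F : 'cV[R]_d -> R)
    (x : 'cV[R]_d) : Prop :=
  forall x', F x <= F x'.

Definition regular_subdiff {R : realType} {d : nat} (g : 'cV[R]_d -> R)
    (x : 'cV[R]_d) : set 'cV[R]_d :=
  [set v | (0 <= limf_einf
     (fun x' => ((g x' - g x - dotv v (x' - x)) / enorm (x' - x))%:E) x^')%E].

Definition limiting_subdiff {R : realType} {d : nat} (g : 'cV[R]_d -> R)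
    (x : 'cV[R]_d) : set 'cV[R]_d :=
  [set v | exists xs vs : nat -> 'cV[R]_d,
     [/\ xs @ \oo --> x, (fun j => g (xs j)) @ \oo --> g x,
         forall j, regular_subdiff g (xs j) (vs j) & vs @ \oo --> v]].

Definition limiting_critical {R : realType} {d : nat} (g : 'cV[R]_d -> R)
    (x : 'cV[R]_d) : Prop :=
  limiting_subdiff g x 0.

Definition lsq {R : realType} {p n : nat} (A : 'M[R]_(p, n)) (b : 'cV[R]_p)
    (u : 'cV[R]_n) : R :=
  2^-1 * enorm (A *m u - b) ^+ 2.

Definition zmap {R : realType} {p n m : nat} (A : 'M[R]_(p, n)) (b : 'cV[R]_p)
    (W : 'M[R]_(m, n)) (beta : R) (u : 'cV[R]_n) : 'cV[R]_m :=
  pinv W^T *m (- grad (lsq A b) u - beta *: (W^T *m W *m u)).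

Definition hfun {R : realType} {p n m : nat} (A : 'M[R]_(p, n)) (b : 'cV[R]_p)
    (W : 'M[R]_(m, n)) (lambda beta rho : R)
    (u : 'cV[R]_n) (y : 'cV[R]_m) : R :=
  lsq A b u + dotv (W *m u - y) (zmap A b W beta u) + lambda * norm0 y
  + beta / 2 * enorm (W *m u) ^+ 2 + rho / 2 * enorm (W *m u - y) ^+ 2.

(* The pair (u, y) is the stacked vector col_mx u y, so that the Euclidean
   norm and the subdifferential on R^n x R^m are those of 'cV_(n + m). *)
Definition hpair {R : realType} {p n m : nat} (A : 'M[R]_(p, n)) (b : 'cV[R]_p)
    (W : 'M[R]_(m, n)) (lambda beta rho : R) (x : 'cV[R]_(n + m)) : R :=
  hfun A b W lambda beta rho (usubmx x) (dsubmx x).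

Definition u_objective {R : realType} {p n m : nat} (A : 'M[R]_(p, n))
    (b : 'cV[R]_p) (W : 'M[R]_(m, n)) (beta rho tk : R)
    (uk : 'cV[R]_n) (yk zk : 'cV[R]_m) (u : 'cV[R]_n) : R :=
  lsq A b u + dotv (W *m u - yk) zk + beta / 2 * enorm (W *m u) ^+ 2
  + tk / 2 * enorm (u - uk) ^+ 2 + rho / 2 * enorm (W *m u - yk) ^+ 2.

Definition y_objective {R : realType} {n m : nat} (W : 'M[R]_(m, n))
    (lambda rho tk : R) (u1 : 'cV[R]_n) (yk z1 : 'cV[R]_m)
    (y : 'cV[R]_m) : R :=
  lambda * norm0 y + dotv (W *m u1 - y) z1
  + tk / 2 * enorm (y - yk) ^+ 2 + rho / 2 * enorm (W *m u1 - y) ^+ 2.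

(* For tk > 0 the u-objective is strictly convex, so that being a minimizer
   amounts to being the unique one. *)
Definition algorithmA {R : realType} {p n m : nat} (A : 'M[R]_(p, n))
    (b : 'cV[R]_p) (W : 'M[R]_(m, n)) (lambda beta rho : R) (t : nat -> R)
    (u : nat -> 'cV[R]_n) (y z : nat -> 'cV[R]_m) : Prop :=
  [/\ y 0%N = W *m u 0%N,
      z 0%N = zmap A b W beta (u 0%N) &
      forall k,
        [/\ is_argmin (u_objective A b W beta rho (t k) (u k) (y k) (z k))
              (u k.+1),
            z k.+1 = zmap A b W beta (u k.+1) &
            is_argmin (y_objective W lambda rho (t k) (u k.+1) (y k) (z k.+1))
              (y k.+1)]].

Definition step_bound {R : realType} {p n m : nat} (A : 'M[R]_(p, n))
    (W : 'M[R]_(m, n)) (beta : R) : R :=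
  let M := A^T *m A + beta *: (W^T *m W) in
  4 * (specnorm (W^T *m pinv W^T *m M)
       + specnorm (W^T *m W) * specnorm (pinv W) ^+ 2 * specnorm M
       + (specnorm M + 1) * specnorm (pinv W) ^+ 2 * specnorm M).

(* Main.v *)
(* Write [h = q + lambda * norm0 y] with [q] quadratic in the pair [(u, y)].
   Comparing consecutive iterates in both minimization steps, the lower bound
   on [t_k] makes [h] decrease by at least [c/2] times the squared step, so the
   steps tend to [0].  Hard thresholding keeps the nonzero entries of [y]
   away from [0], so the support of [y] is eventually constant, and from then
   on the iteration is a descent method for the restriction of [q] to a
   coordinate subspace, the gradient of the restriction being bounded by the
   step.  For any quadratic function, convex or not, the gap to the critical
   value is at most a constant times the squared gradient (the
   Kurdyka-Lojasiewicz inequality with exponent 1/2); hence the gap, then the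
   steps, decay geometrically and the iterates converge linearly.  At the limit
   the gradient of [q] vanishes along the support, which makes [0] a regular
   subgradient of [h]. *)
Require Import Defs.
From HB Require Import structures.
From mathcomp Require Import all_boot all_order all_algebra.
From mathcomp Require Import all_classical all_reals all_analysis.
From mathcomp Require Import ring lra.

Set Implicit Arguments.
Unset Strict Implicit.
Unset Printing Implicit Defensive.

Import Order.TTheory GRing.Theory Num.Theory.
Import numFieldNormedType.Exports.
Local Open Scope classical_set_scope.
Local Open Scope ring_scope.

(* all_classical also exports a [pinv]. *)
Local Notation pinv := Defs.pinv.

(** * Euclidean inner product, Euclidean norm and spectral norm *)

Section Euclidean.
Context {R : realType}.
Implicit Types d p q : nat.

Lemma dotvC d (x y : 'cV[R]_d) : dotv x y = dotv y x.
Proof. by apply: eq_bigr => i _; rewrite mulrC. Qed.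

Lemma dotvDl d (x1 x2 y : 'cV[R]_d) : dotv (x1 + x2) y = dotv x1 y + dotv x2 y.
Proof.
by rewrite /dotv -big_split; apply: eq_bigr => i _; rewrite mxE mulrDl.
Qed.

Lemma dotvDr d (x y1 y2 : 'cV[R]_d) : dotv x (y1 + y2) = dotv x y1 + dotv x y2.
Proof. by rewrite dotvC dotvDl !(dotvC _ x). Qed.

Lemma dotvZl d a (x y : 'cV[R]_d) : dotv (a *: x) y = a * dotv x y.
Proof.
by rewrite /dotv mulr_sumr; apply: eq_bigr => i _; rewrite mxE mulrA.
Qed.

Lemma dotvZr d a (x y : 'cV[R]_d) : dotv x (a *: y) = a * dotv x y.
Proof. by rewrite dotvC dotvZl dotvC. Qed.

Lemma dotvNl d (x y : 'cV[R]_d) : dotv (- x) y = - dotv x y.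
Proof. by rewrite -scaleN1r dotvZl mulN1r. Qed.

Lemma dotvNr d (x y : 'cV[R]_d) : dotv x (- y) = - dotv x y.
Proof. by rewrite dotvC dotvNl dotvC. Qed.

Definition dotvE := (dotvDl, dotvDr, dotvNl, dotvNr, dotvZl, dotvZr).

Lemma dot0v d (x : 'cV[R]_d) : dotv 0 x = 0.
Proof. by rewrite -(scale0r 0) dotvZl mul0r. Qed.

Lemma dotv_mulmxr p q (N : 'M[R]_(p, q)) x y :
  dotv x (N *m y) = dotv (N^T *m x) y.
Proof.
rewrite /dotv (eq_bigr (fun i => \sum_j x i 0 * N i j * y j 0)); last first.
  by move=> i _; rewrite mxE mulr_sumr; apply: eq_bigr => j _; rewrite mulrA.
rewrite exchange_big; apply: eq_bigr => j _; rewrite mxE mulr_suml.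
by apply: eq_bigr => i _; rewrite mxE (mulrC (N i j)).
Qed.

Lemma dotv_mulmxl p q (N : 'M[R]_(p, q)) x y :
  dotv (N *m x) y = dotv x (N^T *m y).
Proof. by rewrite dotv_mulmxr trmxK. Qed.

Lemma dotv_trmxr q r (N : 'M[R]_(q, r)) x y :
  dotv x (N^T *m y) = dotv (N *m x) y.
Proof. by rewrite dotv_mulmxr trmxK. Qed.

Lemma dotv_trmxl q r (N : 'M[R]_(q, r)) x y :
  dotv (N^T *m x) y = dotv x (N *m y).
Proof. by rewrite dotv_mulmxl trmxK. Qed.

Lemma trmx_gram q r (N : 'M[R]_(q, r)) : (N^T *m N)^T = N^T *m N.
Proof. by rewrite trmx_mul trmxK. Qed.

Lemma dotv_col_mx p q (x1 y1 : 'cV[R]_p) (x2 y2 : 'cV[R]_q) :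
  dotv (col_mx x1 x2) (col_mx y1 y2) = dotv x1 y1 + dotv x2 y2.
Proof.
rewrite /dotv big_split_ord /=.
by congr (_ + _); apply: eq_bigr => i _; rewrite ?col_mxEu ?col_mxEd.
Qed.

Lemma dotv_delta d (x : 'cV[R]_d) i : dotv x (delta_mx i 0) = x i 0.
Proof.
rewrite /dotv (bigD1 i) //= mxE !eqxx mulr1 big1 ?addr0 // => j ji.
by rewrite mxE (negPf ji) mulr0.
Qed.

Lemma dotv_ge0 d (x : 'cV[R]_d) : 0 <= dotv x x.
Proof. by apply: sumr_ge0 => i _; rewrite -expr2 sqr_ge0. Qed.

Lemma dotv_eq0 d (x : 'cV[R]_d) : (dotv x x == 0) = (x == 0).
Proof.
apply/idP/eqP => [|->]; last by rewrite dot0v.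
rewrite psumr_eq0 => [/allP x0|i _]; last by rewrite -expr2 sqr_ge0.
apply/colP => i; rewrite mxE; apply/eqP.
by have := x0 i (mem_index_enum _); rewrite /= mulf_eq0 orbb.
Qed.

Lemma enorm_ge0 d (x : 'cV[R]_d) : 0 <= enorm x.
Proof. exact: sqrtr_ge0. Qed.

Lemma sqr_enorm d (x : 'cV[R]_d) : enorm x ^+ 2 = dotv x x.
Proof. by rewrite sqr_sqrtr ?dotv_ge0. Qed.

Lemma enorm0 d : enorm (0 : 'cV[R]_d) = 0.
Proof. by rewrite /enorm dot0v sqrtr0. Qed.

Lemma enorm_eq0 d (x : 'cV[R]_d) : (enorm x == 0) = (x == 0).
Proof. by rewrite -dotv_eq0 -sqr_enorm sqrf_eq0. Qed.

Lemma enormZ d a (x : 'cV[R]_d) : enorm (a *: x) = `|a| * enorm x.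
Proof.
by rewrite /enorm dotvZl dotvZr mulrA -expr2 sqrtrM ?sqr_ge0 // sqrtr_sqr.
Qed.

Lemma enormN d (x : 'cV[R]_d) : enorm (- x) = enorm x.
Proof. by rewrite -scaleN1r enormZ normrN1 mul1r. Qed.

Lemma enormBC d (x y : 'cV[R]_d) : enorm (x - y) = enorm (y - x).
Proof. by rewrite -enormN opprB. Qed.

Lemma cauchy_schwarz d (x y : 'cV[R]_d) : `|dotv x y| <= enorm x * enorm y.
Proof.
have [y0|y0] := eqVneq (dotv y y) 0.
  move/eqP: (y0); rewrite dotv_eq0 => /eqP ->.
  by rewrite dotvC dot0v normr0 mulr_ge0 ?enorm_ge0.
have yy : 0 < dotv y y by rewrite lt_neqAle eq_sym y0 dotv_ge0.
rewrite -ler_sqr ?nnegrE ?mulr_ge0 ?enorm_ge0 // exprMn !sqr_enorm.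
rewrite real_normK ?num_real //.
have := dotv_ge0 (dotv y y *: x - dotv x y *: y).
rewrite !dotvE (dotvC y x).
set a := dotv x x; set e := dotv x y; set f := dotv y y => Hge.
have : 0 <= f * (a * f - e ^+ 2) by lra.
by rewrite pmulr_rge0 // subr_ge0.
Qed.

Lemma dotv_le d (x y : 'cV[R]_d) : dotv x y <= enorm x * enorm y.
Proof. exact: le_trans (ler_norm _) (cauchy_schwarz _ _). Qed.

Lemma enormD d (x y : 'cV[R]_d) : enorm (x + y) <= enorm x + enorm y.
Proof.
rewrite -ler_sqr ?nnegrE ?addr_ge0 ?enorm_ge0 // sqrrD !sqr_enorm !dotvE.
by rewrite (dotvC y x); have := dotv_le x y; lra.
Qed.

Lemma enormB d (x y : 'cV[R]_d) : enorm (x - y) <= enorm x + enorm y.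
Proof. by rewrite -(enormN y) enormD. Qed.

Lemma ler_coord_enorm d (x : 'cV[R]_d) i : `|x i 0| <= enorm x.
Proof.
rewrite -ler_sqr ?nnegrE ?enorm_ge0 // sqr_enorm real_normK ?num_real //.
rewrite /dotv (bigD1 i) //= expr2 lerDl.
by apply: sumr_ge0 => j _; rewrite -expr2 sqr_ge0.
Qed.

Lemma enorm_le_sum d (x : 'cV[R]_d) : enorm x <= \sum_i `|x i 0|.
Proof.
have S0 : 0 <= \sum_i `|x i 0| by exact: sumr_ge0.
rewrite -ler_sqr ?nnegrE ?enorm_ge0 // sqr_enorm expr2 mulr_suml.
apply: ler_sum => i _; rewrite -[x i 0 * _]ger0_norm -?expr2 ?sqr_ge0 // expr2 normrM.
by rewrite ler_wpM2l // (bigD1 i) //= lerDl sumr_ge0.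
Qed.

Lemma enorm_col_mx_le p q (x : 'cV[R]_p) (y : 'cV[R]_q) :
  enorm (col_mx x y) <= enorm x + enorm y.
Proof.
rewrite -ler_sqr ?nnegrE ?addr_ge0 ?enorm_ge0 // sqrrD !sqr_enorm dotv_col_mx.
by rewrite -!sqr_enorm; have := mulr_ge0 (enorm_ge0 x) (enorm_ge0 y); lra.
Qed.

Lemma enorm_col_mxl p q (x : 'cV[R]_p) (y : 'cV[R]_q) :
  enorm x <= enorm (col_mx x y).
Proof.
rewrite -ler_sqr ?nnegrE ?enorm_ge0 // !sqr_enorm dotv_col_mx.
by rewrite lerDl dotv_ge0.
Qed.

Lemma enorm_col_mxr p q (x : 'cV[R]_p) (y : 'cV[R]_q) :
  enorm y <= enorm (col_mx x y).
Proof.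
rewrite -ler_sqr ?nnegrE ?enorm_ge0 // !sqr_enorm dotv_col_mx.
by rewrite lerDr dotv_ge0.
Qed.

(** The sum of the Euclidean norms of the rows is an upper bound, so the [sup] in [specnorm] is a
    genuine supremum and not a default value. *)
Lemma specnorm_has_sup p q (N : 'M[R]_(p, q)) :
  has_sup [set enorm (N *m v) | v in [set v : 'cV[R]_q | enorm v <= 1]].
Proof.
split; first by exists (enorm (N *m 0)), 0; rewrite //= enorm0.
exists (\sum_i enorm (row i N)^T) => _ [v /= v1 <-].
apply: le_trans (enorm_le_sum _) _; apply: ler_sum => i _.
have -> : (N *m v) i 0 = dotv (row i N)^T v.
  by rewrite mxE; apply: eq_bigr => j _; rewrite !mxE.
apply: le_trans (cauchy_schwarz _ _) _.
by rewrite ler_piMr ?enorm_ge0.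
Qed.

Lemma specnorm_ge0 p q (N : 'M[R]_(p, q)) : 0 <= specnorm N.
Proof.
apply: le_trans (enorm_ge0 (N *m 0)) _.
by apply: (sup_upper_bound (specnorm_has_sup N)); exists 0; rewrite //= enorm0.
Qed.

Lemma enorm_mulmx p q (N : 'M[R]_(p, q)) v :
  enorm (N *m v) <= specnorm N * enorm v.
Proof.
have [v0|v0] := eqVneq (enorm v) 0.
  move/eqP: v0; rewrite enorm_eq0 => /eqP ->.
  by rewrite mulmx0 !enorm0 mulr0.
have vp : 0 < enorm v by rewrite lt_neqAle eq_sym v0 enorm_ge0.
have : enorm (N *m ((enorm v)^-1 *: v)) <= specnorm N.
  apply: (sup_upper_bound (specnorm_has_sup N)); exists ((enorm v)^-1 *: v) => //=.
  by rewrite enormZ ger0_norm ?invr_ge0 ?enorm_ge0 // mulVf.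
rewrite -scalemxAr enormZ ger0_norm ?invr_ge0 ?enorm_ge0 //.
by rewrite mulrC ler_pdivrMr.
Qed.

(** The square of the left side is [dotv v (N *m (N^T *m v))]; Cauchy-Schwarz bounds it, and one
    factor [enorm (N^T *m v)] cancels. *)
Lemma enorm_trmx_mulmx p q (N : 'M[R]_(p, q)) v :
  enorm (N^T *m v) <= specnorm N * enorm v.
Proof.
have [v0|v0] := eqVneq (enorm (N^T *m v)) 0.
  by rewrite v0 mulr_ge0 ?specnorm_ge0 ?enorm_ge0.
have vp : 0 < enorm (N^T *m v) by rewrite lt_neqAle eq_sym v0 enorm_ge0.
rewrite -(ler_pM2r vp) -expr2 sqr_enorm dotv_mulmxl trmxK mulrAC mulrC.
apply: le_trans (dotv_le _ _) _; rewrite ler_wpM2l ?enorm_ge0 //.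
exact: enorm_mulmx.
Qed.

Lemma dotv_mulmx_bound d (H : 'M[R]_d) x :
  `|dotv x (H *m x)| <= specnorm H * enorm x ^+ 2.
Proof.
apply: le_trans (cauchy_schwarz _ _) _.
by rewrite expr2 mulrCA ler_wpM2l ?enorm_ge0 ?enorm_mulmx.
Qed.

End Euclidean.

(** * Real sequences: geometric increments and vanishing decrements *)

Section RealSequences.
Context {R : realType}.

Lemma expr_eventually_lt (tau e : R) : 0 <= tau -> tau < 1 -> 0 < e ->
  exists k, tau ^+ k < e.
Proof.
move=> t0 t1 e0; have : (GRing.exp tau : R^nat) @ \oo --> (0 : R).
  by apply: cvg_expr; rewrite ger0_norm.
move=> /cvgrPdist_lt/(_ e e0)[N _ /(_ N (leqnn _))].
by rewrite sub0r normrN ger0_norm ?exprn_ge0 // => ?; exists N.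
Qed.

Lemma le_geometric_le0 (a C tau : R) : 0 <= C -> 0 <= tau -> tau < 1 ->
  (forall k, a <= C * tau ^+ k) -> a <= 0.
Proof.
move=> C0 t0 t1 ale; rewrite leNgt; apply/negP => a0.
have [|k] := @expr_eventually_lt tau (a / (C + 1)) t0 t1.
  by rewrite divr_gt0 //; lra.
rewrite ltr_pdivlMr; last lra.
by have := ale k; have := exprn_ge0 k t0; nra.
Qed.

(** Nested intervals: the radius [K * tau ^+ k] shrinks by [C * tau ^+ k] at each step, exactly
    enough to absorb the increment. The limit is the supremum of the left endpoints. *)
Lemma geometric_increments (a : nat -> R) (C tau : R) :
  0 <= C -> 0 <= tau -> tau < 1 ->
  (forall k, `|a k.+1 - a k| <= C * tau ^+ k) ->
  exists l, forall k, `|a k - l| <= C / (1 - tau) * tau ^+ k.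
Proof.
move=> C0 t0 t1 aC; set K := C / (1 - tau).
have CK : C = K * (1 - tau) by rewrite /K divfK //; lra.
have K0 : 0 <= K by rewrite divr_ge0 //; lra.
pose lo k := a k - K * tau ^+ k; pose up k := a k + K * tau ^+ k.
have loS k : lo k <= lo k.+1.
  have := aC k; rewrite ler_norml /lo exprS CK => /andP[].
  by set s := tau ^+ k; lra.
have upS k : up k.+1 <= up k.
  have := aC k; rewrite ler_norml /up exprS CK => /andP[].
  by set s := tau ^+ k; lra.
have loM : {homo lo : i j / (i <= j)%N >-> i <= j}.
  by apply: homo_leq => // ? ? ?; exact: le_trans.
have upM i j : (i <= j)%N -> up j <= up i.
  move=> /subnK <-; elim: (j - i)%N => [//|k IH].
  by rewrite addSn; exact: le_trans IH.
have lu k : lo k <= up k.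
  by rewrite /lo /up; have := mulr_ge0 K0 (exprn_ge0 k t0); lra.
have loup i j : lo i <= up j.
  have [ij|/ltnW ji] := leqP i j; first exact: le_trans (loM _ _ ij) (lu j).
  exact: le_trans (lu i) (upM _ _ ji).
have ub : has_sup (range lo).
  by split; [exists (lo 0%N), 0%N|exists (up 0%N) => _ [i _ <-]].
exists (sup (range lo)) => k; rewrite ler_distl.
have lok : lo k <= sup (range lo) by apply: (sup_upper_bound ub); exists k.
have upk : sup (range lo) <= up k.
  by apply: ge_sup; [exists (lo 0%N), 0%N|move=> _ [i _ <-]].
by move: lok upk; rewrite /lo /up => ? ?; apply/andP; split; lra.
Qed.

(** Once a term is within [e] of the infimum, no later decrement can exceed [e]. *)
Lemma decrements_vanish (a : nat -> R) (B : R) :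
  (forall k, a k.+1 <= a k) -> (forall k, B <= a k) ->
  forall e, 0 < e -> exists N, forall k, (N <= k)%N -> a k - a k.+1 <= e.
Proof.
move=> aS aB e e0.
have hi : has_inf (range a).
  by split; [exists (a 0%N), 0%N|exists B => _ [i _ <-]].
have [_ [N _ <-] aN] := inf_adherent e0 hi.
exists N => k Nk.
have aM i j : (i <= j)%N -> a j <= a i.
  move=> /subnK <-; elim: (j - i)%N => [//|l IH].
  by rewrite addSn; exact: le_trans IH.
have /(ge_inf hi.2) : range a (a k.+1) by exists k.+1.
by have := aM _ _ Nk; lra.
Qed.

End RealSequences.

(** * Quadratic functions, possibly nonconvex, and their critical points *)

Section Quadratic.
Context {R : realType}.

Definition qfun d (H : 'M[R]_d) (l : 'cV[R]_d) (c : R) (x : 'cV[R]_d) : R :=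
  2^-1 * dotv x (H *m x) + dotv l x + c.

Variables (d : nat) (H : 'M[R]_d) (l : 'cV[R]_d) (c : R).
Hypothesis Hsym : H^T = H.
Local Notation q := (qfun H l c).

Lemma qfunD x v :
  q (x + v) = q x + dotv (H *m x + l) v + 2^-1 * dotv v (H *m v).
Proof.
rewrite /qfun mulmxDr !dotvE.
have -> : dotv v (H *m x) = dotv (H *m x) v by rewrite dotvC.
have -> : dotv x (H *m v) = dotv (H *m x) v by rewrite dotv_mulmxr Hsym.
by field.
Qed.

Lemma qfun_bounded B : exists C, forall x, enorm x <= B -> - C <= q x.
Proof.
exists (2^-1 * (specnorm H * B ^+ 2) + enorm l * B - c) => x xB.
have B0 : 0 <= B := le_trans (enorm_ge0 x) xB.
have := dotv_mulmx_bound H x; rewrite ler_norml => /andP[+ _].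
have := cauchy_schwarz l x; rewrite ler_norml => /andP[+ _].
have := ler_wpM2l (enorm_ge0 l) xB.
have xB2 : enorm x ^+ 2 <= B ^+ 2 by rewrite ler_sqr ?nnegrE ?enorm_ge0.
have := ler_wpM2l (specnorm_ge0 H) xB2.
rewrite /qfun; lra.
Qed.

Lemma qfun_argmin x : is_argmin q x -> H *m x + l = 0.
Proof.
move=> xmin; have [g gE] : exists g, H *m x + l = g by eexists.
(* A gradient step of length [s], with [s * specnorm H <= 1], would lower [q] by at least [s / 2]
   times the squared norm of [g]. The added 1 keeps [s] well defined when [H = 0]. *)
rewrite gE; set s := (specnorm H + 1)^-1.
have H0 := specnorm_ge0 H.
have s0 : 0 < s by rewrite invr_gt0; lra.
have sH : s * specnorm H <= 1 by rewrite /s mulrC ler_pdivrMr ?mul1r; lra.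
have := xmin (x - s *: g).
rewrite qfunD gE mulmxN -scalemxAr !dotvE -sqr_enorm => Hmin.
have := dotv_mulmx_bound H g; rewrite ler_norml => /andP[_ gH].
apply/eqP; rewrite -enorm_eq0 -sqrf_eq0; apply/eqP/le_anti.
rewrite sqr_ge0 andbT.
move: Hmin.
set e := enorm g ^+ 2 in gH *; set w := dotv g _ in gH * => Hmin.
have e0 : 0 <= e by exact: sqr_ge0.
have : s * (s * w) <= s * e.
  rewrite ler_pM2l //; apply: le_trans (_ : s * (specnorm H * e) <= _).
    by rewrite ler_pM2l.
  by rewrite mulrA ler_piMl.
by move=> ?; rewrite -(pmulr_rle0 _ s0); lra.
Qed.

(* [1 - H H^+] annihilates the range of [H], so it maps [l] into the closure
   of [0]. *)
Lemma qfun_critical_exists :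
  (forall e : R, 0 < e -> exists x, enorm (H *m x + l) <= e) ->
  exists x0, H *m x0 + l = 0.
Proof.
move=> small; have [HXH _ _ _] := pinvP H; set X := pinv H in HXH.
exists (- (X *m l)); rewrite mulmxN addrC mulmxA.
set r := l - _; set N := 1%:M - H *m X.
have rE x : r = N *m (H *m x + l).
  rewrite /N mulmxBl mul1mx mulmxDr !mulmxA HXH opprD.
  by rewrite addrACA subrr add0r.
apply/eqP; rewrite -enorm_eq0; apply/eqP/le_anti; rewrite enorm_ge0 andbT.
have N0 := specnorm_ge0 N.
apply/ler_addgt0Pl => e e0; rewrite addr0.
have [|x xe] := small (e / (specnorm N + 1)); first by rewrite divr_gt0 //; lra.
rewrite (rE x); apply: le_trans (enorm_mulmx _ _) _.
move: xe; rewrite ler_pdivlMr; last lra.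
by have := enorm_ge0 (H *m x + l); nra.
Qed.

(* With [v = x - x0], [v^T H v = (H v)^T H^+ (H v)]: no spectral decomposition
   is needed. *)
Lemma qfun_gradient_dominated x0 x : H *m x0 + l = 0 ->
  `|q x - q x0| <= specnorm (pinv H) * enorm (H *m x + l) ^+ 2.
Proof.
move=> x0crit; set v := x - x0.
have xE : x = x0 + v by rewrite /v addrC subrK.
have gE : H *m x + l = H *m v by rewrite xE mulmxDr addrAC x0crit add0r.
rewrite gE xE qfunD x0crit dot0v addr0 addrAC subrr add0r normrM.
rewrite ger0_norm ?invr_ge0 //.
have -> : dotv v (H *m v) = dotv (H *m v) (pinv H *m (H *m v)).
  rewrite dotv_mulmxl Hsym !mulmxA; congr (dotv v (_ *m _)).
  by have [-> _ _ _] := pinvP H.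
have := dotv_mulmx_bound (pinv H) (H *m v).
by have := normr_ge0 (dotv (H *m v) (pinv H *m (H *m v))); lra.
Qed.

End Quadratic.

(** * Linear convergence of descent sequences for a quadratic *)

Section LinearConvergence.
Context {R : realType} {d : nat}.

(** Passage to the limit in an affine equation: replacing [x k] by [xs] costs at most
    [specnorm N * enorm (x k - xs)], so the norm at [xs] lies below a vanishing geometric
    sequence. *)
Lemma mulmx_eq0_geometric_limit e (N : 'M[R]_(e, d)) (x : nat -> 'cV[R]_d)
    xs c1 tau v :
  0 <= c1 -> 0 <= tau -> tau < 1 ->
  (forall k, enorm (x k - xs) <= c1 * tau ^+ k) ->
  (forall k, enorm (N *m x k + v) <= c1 * tau ^+ k) -> N *m xs + v = 0.
Proof.
move=> c0 t0 t1 xlim Nlim; apply/eqP; rewrite -enorm_eq0.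
apply/eqP/le_anti; rewrite enorm_ge0 andbT.
have N0 := specnorm_ge0 N.
apply: (@le_geometric_le0 _ _ ((specnorm N + 1) * c1) tau) => // [|k].
  by rewrite mulr_ge0 // addr_ge0.
have -> : N *m xs + v = N *m x k + v - N *m (x k - xs).
  by rewrite mulmxBr opprB [RHS]addrC subrKA.
apply: le_trans (enormB _ _) _; rewrite -mulrA mulrDl mul1r addrC lerD //.
by apply: le_trans (enorm_mulmx _ _) _; rewrite ler_wpM2l.
Qed.

Lemma geometric_increments_cV (x : nat -> 'cV[R]_d) (C tau : R) :
  0 <= C -> 0 <= tau -> tau < 1 ->
  (forall k, enorm (x k.+1 - x k) <= C * tau ^+ k) ->
  exists xs, exists2 c1, 0 <= c1 & forall k, enorm (x k - xs) <= c1 * tau ^+ k.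
Proof.
move=> C0 t0 t1 dx.
have /boolp.choice[xs xsP] i : exists li, forall k,
    `|x k i 0 - li| <= C / (1 - tau) * tau ^+ k.
  apply: geometric_increments => // k; apply: le_trans (dx k).
  by have := ler_coord_enorm (x k.+1 - x k) i; rewrite !mxE.
exists (\col_i xs i), (C / (1 - tau) *+ d).
  by rewrite mulrn_wge0 // divr_ge0 //; lra.
move=> k; apply: le_trans (enorm_le_sum _) _.
rewrite mulrnAl -[d in leRHS]card_ord -sumr_const; apply: ler_sum => i _.
by rewrite !mxE.
Qed.

Variables (H : 'M[R]_d) (l : 'cV[R]_d) (c a b : R) (x : nat -> 'cV[R]_d).
Hypotheses (Hsym : H^T = H) (a0 : 0 < a).
Hypothesis descent : forall k,
  qfun H l c (x k.+1) + a * enorm (x k.+1 - x k) ^+ 2 <= qfun H l c (x k).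
Hypothesis error_bound : forall k,
  enorm (H *m x k.+1 + l) <= b * enorm (x k.+1 - x k).
Hypothesis steps_vanish : forall e : R, 0 < e ->
  exists N, forall k, (N <= k)%N -> enorm (x k.+1 - x k) <= e.

(** The gap [E k] to the critical value is controlled by the squared step ([Edom]), and the squared
    step by the decrease of the gap ([Estep]). Together they contract the gap geometrically, and the
    steps inherit the square root of that rate. *)
Lemma descent_linear_convergence : exists xs c1 tau,
  [/\ H *m xs + l = 0, 0 < c1, 0 <= tau, tau < 1 &
      forall k, enorm (x k - xs) <= c1 * tau ^+ k].
Proof.
pose B : R := `|b| + 1.
have B0 : 0 < B by rewrite /B; have := normr_ge0 b; lra.
have grad_le k : enorm (H *m x k.+1 + l) <= B * enorm (x k.+1 - x k).
  apply: le_trans (error_bound k) _; rewrite ler_wpM2r ?enorm_ge0 //.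
  by rewrite /B; have := ler_norm b; lra.
have [|x0 x0crit] := @qfun_critical_exists _ _ H l.
  move=> e e0; have [|N NP] := steps_vanish (e := e / B); first exact: divr_gt0.
  exists (x N.+1); apply: le_trans (grad_le N) _.
  by rewrite mulrC -ler_pdivlMr // NP.
pose E k := qfun H l c (x k) - qfun H l c x0.
(* Chosen so that [theta * a] is the constant of gradient domination combined with the error bound;
   the added 1 makes it positive. *)
pose theta := (specnorm (pinv H) + 1) * B ^+ 2 / a.
have theta0 : 0 < theta.
  rewrite /theta divr_gt0 // mulr_gt0 ?exprn_gt0 //.
  by have := specnorm_ge0 (pinv H); lra.
have theta_a : theta * a = (specnorm (pinv H) + 1) * B ^+ 2.
  by rewrite /theta divfK ?gt_eqF.
have Edom k : `|E k.+1| <= theta * a * enorm (x k.+1 - x k) ^+ 2.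
  rewrite theta_a -mulrA -exprMn.
  apply: le_trans (qfun_gradient_dominated c Hsym _ x0crit) _.
  have X0 := specnorm_ge0 (pinv H).
  have gB : enorm (H *m x k.+1 + l) ^+ 2 <= (B * enorm (x k.+1 - x k)) ^+ 2.
    by rewrite ler_sqr ?nnegrE ?mulr_ge0 ?enorm_ge0 ?(ltW B0).
  have g0 := sqr_ge0 (enorm (H *m x k.+1 + l)).
  by apply: ler_pM => //; lra.
have Estep k : E k.+1 + a * enorm (x k.+1 - x k) ^+ 2 <= E k.
  by rewrite /E; have := descent k; lra.
(* A negative gap would stay at or below [E k] by monotonicity, while [Edom] with a small enough
   step forces a later gap to have absolute value at most [- E k / 2]. *)
have E0 k : 0 <= E k.
  rewrite leNgt; apply/negP => Ek.
  have Emono j : (k <= j)%N -> E j <= E k.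
    move=> /subnK <-; elim: (j - k)%N => [|i IH]; first by [].
    rewrite addSn; apply: le_trans IH; apply: le_trans (Estep _).
    by rewrite lerDl mulr_ge0 ?sqr_ge0 // ltW.
  have ta : 0 < theta * a by rewrite mulr_gt0.
  have s0 : 0 < - E k / (theta * a) / 2.
    by apply: divr_gt0 => //; apply: divr_gt0 => //; rewrite oppr_gt0.
  have [|N NP] := steps_vanish (e := Num.sqrt (- E k / (theta * a) / 2)).
    by rewrite sqrtr_gt0.
  pose j := maxn N k.
  have := NP j (leq_maxl _ _); rewrite -ler_sqr ?nnegrE ?enorm_ge0 ?sqrtr_ge0 //.
  rewrite (sqr_sqrtr (ltW s0)) -(ler_pM2l ta) => small.
  have Ej := Emono j.+1 (leqW (leq_maxr _ _)).
  have := le_trans (Edom j) small; rewrite mulrA (mulrC (theta * a)).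
  rewrite divfK ?gt_eqF //.
  by rewrite ler_norml => /andP[]; lra.
(* From [E k.+1 <= theta * (E k - E k.+1)], solved for [E k.+1]. *)
pose r := theta / (1 + theta).
have r0 : 0 < r by rewrite divr_gt0 //; lra.
have r1 : r < 1 by rewrite /r ltr_pdivrMr; lra.
have Er k : E k <= E 0%N * r ^+ k.
  elim: k => [|k IH]; first by rewrite expr0 mulr1.
  rewrite exprS mulrCA; apply: le_trans (_ : r * E k <= _); last by rewrite ler_pM2l.
  rewrite /r mulrAC ler_pdivlMr; [|by apply: addr_gt0].
  have := Estep k; have := Edom k; rewrite ger0_norm //.
  rewrite -mulrA; move: (a * _) => s Es1 Es2.
  have : theta * s <= theta * (E k - E k.+1) by rewrite ler_pM2l //; lra.
  by lra.
pose tau := Num.sqrt r; pose C := Num.sqrt (E 0%N / a).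
have tau0 : 0 <= tau by exact: sqrtr_ge0.
have tau1 : tau < 1 by rewrite /tau -sqrtr1 ltr_sqrt.
have C0 : 0 <= C by exact: sqrtr_ge0.
have steps_le k : enorm (x k.+1 - x k) <= C * tau ^+ k.
  rewrite -ler_sqr ?nnegrE ?mulr_ge0 ?exprn_ge0 ?enorm_ge0 //.
  rewrite exprMn exprAC (sqr_sqrtr (ltW r0)).
  rewrite (sqr_sqrtr (divr_ge0 (E0 0%N) (ltW a0))).
  rewrite mulrAC ler_pdivlMr // (mulrC _ a); apply: le_trans _ (Er k).
  by have := Estep k; have := E0 k.+1; lra.
have [xs [c1 c10 xsP]] := geometric_increments_cV C0 tau0 tau1 steps_le.
have BC0 : 0 <= B * C by rewrite mulr_ge0 // ltW.
exists xs, (c1 + 1), tau; split=> //; [|lra|]; last first.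
  move=> k; apply: le_trans (xsP k) _.
  by rewrite ler_wpM2r ?exprn_ge0 //; lra.
(* The sequence is shifted by one because the error bound controls the gradient at the later end of
   each step. *)
apply: (@mulmx_eq0_geometric_limit _ H (fun k => x k.+1) _ (c1 + B * C) tau) => //.
- by rewrite addr_ge0.
- move=> k; apply: le_trans (xsP _) _; rewrite exprS mulrA ler_wpM2r ?exprn_ge0 //.
  by nra.
- move=> k; apply: le_trans (grad_le k) _.
  apply: le_trans (ler_wpM2l (ltW B0) (steps_le k)) _; rewrite mulrA.
  by rewrite ler_wpM2r ?exprn_ge0 // lerDr.
Qed.
End LinearConvergence.

(** * The support count as a cardinal, and the gradient of a quadratic *)

Section Grad.
Context {R : realType} {d : nat}.

Lemma norm0E (y : 'cV[R]_d) : norm0 y = #|[pred i | y i 0 != 0]|%:R.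
Proof. rewrite /norm0; congr (_%:R); apply: eq_card => i; rewrite inE.
by apply/idP/idP => [/set_mem|?]; [|exact/mem_set].
Qed.

Variables (H : 'M[R]_d) (l : 'cV[R]_d) (c : R).
Hypothesis Hsym : H^T = H.

(** Along a fixed direction the difference quotient is exactly affine in the increment [h] for
    [h != 0], so its limit is the value of that affine function at 0. *)
Lemma grad_qfun x : grad (qfun H l c) x = H *m x + l.
Proof.
apply/colP => i; rewrite mxE -dotv_delta; set v := delta_mx i 0.
apply: cvg_lim => //=.
have -> : dotv (H *m x + l) v =
    dotv (H *m x + l) v + 0 * (2^-1 * dotv v (H *m v)).
  by rewrite mul0r addr0.
apply: (@cvg_trans _ ((fun h : R =>
  dotv (H *m x + l) v + h * (2^-1 * dotv v (H *m v))) @ 0^')).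
  apply: near_eq_cvg; near=> h.
  have h0 : h != 0 by near: h; exact: nbhs_dnbhs_neq.
  rewrite (addrC (h *: v)) qfunD // -scalemxAr !(dotvZr, dotvZl) /GRing.scale /=.
  by field.
apply: cvgD; first exact: cvg_cst.
apply: cvgM; last exact: cvg_cst.
exact: nbhs_dnbhs.
Unshelve. all: by end_near. Qed.
End Grad.

(** * Pseudoinverse of a transpose and the full row rank case *)

Section Pseudoinverse.
Context {R : realType}.

Lemma penrose_trmx p q (N : 'M[R]_(p, q)) X : penrose N X -> penrose N^T X^T.
Proof.
case=> N1 N2 N3 N4; split; rewrite -!trmx_mul ?mulmxA ?N1 ?N2 //.
- by rewrite N4.
- by rewrite N3.
Qed.

Lemma pinv_trmx p q (N : 'M[R]_(p, q)) : pinv N^T = (pinv N)^T.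
Proof. exact: penrose_unique (pinvP _) (penrose_trmx (pinvP N)). Qed.

(** Full row rank lets [N] be cancelled on the right in [N *m pinv N *m N = N]; the rest is
    transposition. *)
Lemma pinv_trmx_mulmx p q (N : 'M[R]_(p, q)) :
  row_free N -> pinv N^T *m N^T = 1%:M.
Proof.
move=> Nfree; have [NXN _ _ _] := pinvP N; apply: trmx_inj.
rewrite pinv_trmx -trmx_mul trmxK trmx1; apply: (row_free_inj Nfree).
by rewrite mul1mx.
Qed.

End Pseudoinverse.

(** * Comparison of support counts *)

Section Norm0.
Context {R : realType} {d : nat}.
Implicit Types y : 'cV[R]_d.

Lemma norm0_ge0 y : 0 <= norm0 y.
Proof. by rewrite norm0E. Qed.

Lemma norm0_le y y' : (forall i, y i 0 != 0 -> y' i 0 != 0) ->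
  norm0 y <= norm0 y'.
Proof.
move=> yy'; rewrite !norm0E ler_nat; apply/subset_leq_card/fintype.subsetP => i.
by rewrite !inE; exact: yy'.
Qed.

Lemma norm0_eq y y' : (forall i, (y i 0 == 0) = (y' i 0 == 0)) ->
  norm0 y = norm0 y'.
Proof. by move=> yy'; apply/le_anti; rewrite !norm0_le // => i; rewrite yy'. Qed.

Lemma norm0_lt y y' j : (forall i, y i 0 != 0 -> y' i 0 != 0) ->
  y j 0 = 0 -> y' j 0 != 0 -> norm0 y + 1 <= norm0 y'.
Proof.
move=> yy' yj y'j; rewrite !norm0E natr1 ler_nat.
apply/proper_card/properP; split.
  by apply/fintype.subsetP => i; rewrite !inE; exact: yy'.
by exists j; rewrite !inE // yj eqxx.
Qed.

End Norm0.

(** * Sufficient conditions for regular subgradients and limiting criticality *)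

Section Subdifferential.
Context {R : realType}.

Lemma nbhs_enorm_lt d (x : 'cV[R]_d) (r : R) : 0 < r ->
  nbhs x [set x' | enorm (x' - x) < r].
Proof.
move=> r0; have d0 : 0 < d.+1%:R :> R by rewrite ltr0n.
(* The ball is for the max norm; dividing by [d.+1] rather than [d] gives a strict inequality and
   covers [d = 0]. *)
apply/nbhs_ballP; exists (r / d.+1%:R); first exact: divr_gt0.
move=> x' xx' /=; apply: le_lt_trans (enorm_le_sum _) _.
apply: (@le_lt_trans _ _ (\sum_(i < d) r / d.+1%:R)).
  apply: ler_sum => i _; rewrite !mxE distrC; apply: ltW.
  by have [_ xx'i] := xx'; exact: xx'i.
rewrite sumr_const card_ord -[ltLHS]mulr_natr -mulrA gtr_pMr // mulrC ltr_pdivrMr //.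
by rewrite mul1r ltr_nat.
Qed.

(** A quadratic minorant bounds the difference quotient below by [- C] times the distance, which is
    at least [- e] within distance [e / (C + 1)]. *)
Lemma regular_subdiff_lower_bound d (g : 'cV[R]_d -> R) x v (C r : R) :
  0 <= C -> 0 < r ->
  (forall w, enorm w < r -> g x + dotv v w - C * enorm w ^+ 2 <= g (x + w)) ->
  regular_subdiff g x v.
Proof.
move=> C0 r0 glb; rewrite /regular_subdiff /= limf_einfE.
apply/lee_subgt0Pr => e e0; rewrite sub0e.
pose s := Num.min r (e / (C + 1)).
have s0 : 0 < s by rewrite lt_min r0 divr_gt0 //; lra.
pose V := [set x' | x' != x /\ enorm (x' - x) < s].
apply: (@le_trans _ _ (ereal_inf
  [set ((g x' - g x - dotv v (x' - x)) / enorm (x' - x))%:E | x' in V])).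
  apply: le_ereal_inf_tmp => _ [x' [x'x x's] <-].
  have w0 : 0 < enorm (x' - x).
    by rewrite lt_neqAle enorm_ge0 eq_sym enorm_eq0 subr_eq0 x'x.
  rewrite -EFinN lee_fin ler_pdivlMr //.
  move: x's; rewrite lt_min => /andP[wr]; rewrite ltr_pdivlMr; last lra.
  move=> we; have := glb _ wr; rewrite (addrC x) subrK.
  move: (enorm _) w0 {wr} we => w w0 we.
  have : w * (w * (C + 1)) <= w * e by rewrite ler_pM2l // ltW.
  by have := sqr_ge0 w; rewrite !expr2; lra.
apply: ereal_sup_ubound; exists V => //.
apply: filterS (nbhs_enorm_lt x s0) => x' /= x's x'x; split => //.
Qed.

Lemma regular_limiting_subdiff d (g : 'cV[R]_d -> R) x :
  regular_subdiff g x `<=` limiting_subdiff g x.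
Proof.
move=> v gv; exists (fun=> x), (fun=> v).
by split=> //; exact: cvg_cst.
Qed.

Lemma nonzero_entries_bounded_away d (y : 'cV[R]_d) :
  exists2 r : R, 0 < r & forall i, y i 0 != 0 -> r <= `|y i 0|.
Proof.
exists (\big[Num.min/1]_(i | y i 0 != 0) `|y i 0|).
  by elim/big_ind: _ => // [a b a0 b0|i yi]; rewrite ?lt_min ?a0 // normr_gt0.
by move=> i yi; exact: bigmin_le_cond.
Qed.

(* Near [x] the count cannot drop; where it stays constant the quadratic part
   moves only along the support, and where it jumps the jump [lambda] absorbs
   the linear term. *)
Lemma limiting_critical_qfun_norm0 n m (H : 'M[R]_(n + m)) l c (lambda : R)
    (g : 'cV[R]_(n + m) -> R) x :
  H^T = H -> 0 < lambda ->
  (forall x', g x' = qfun H l c x' + lambda * norm0 (dsubmx x')) ->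
  (forall w, (forall i, dsubmx x i 0 = 0 -> dsubmx w i 0 = 0) ->
     dotv (H *m x + l) w = 0) ->
  limiting_critical g x.
Proof.
move=> Hsym lam0 gE gradx; apply: regular_limiting_subdiff.
have [r1 r10 r1P] := nonzero_entries_bounded_away (dsubmx x).
set G := enorm (H *m x + l); have G0 : 0 <= G by exact: enorm_ge0.
(* The bound [r1] keeps nonzero entries of [dsubmx x] nonzero; the other bound keeps the linear term
   below [lambda], the price of one new nonzero entry. *)
pose r := Num.min r1 (lambda / (G + 1)).
apply: (@regular_subdiff_lower_bound _ _ _ _ (specnorm H) r).
- exact: specnorm_ge0.
- by rewrite lt_min r10 divr_gt0 //; lra.
move=> w; rewrite lt_min => /andP[wr1]; rewrite ltr_pdivlMr; last lra.
move=> wG; rewrite dot0v addr0 !gE qfunD //.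
have supp i : dsubmx x i 0 != 0 -> dsubmx (x + w) i 0 != 0.
  move=> xi; apply: contraTneq (r1P i xi); rewrite linearD mxE => xw.
  have -> : dsubmx x i 0 = - dsubmx w i 0 by lra.
  rewrite normrN -ltNge; apply: le_lt_trans wr1.
  by rewrite mxE; exact: ler_coord_enorm.
have := dotv_mulmx_bound H w; rewrite ler_norml => /andP[wH _].
have w0 := enorm_ge0 w; have wH0 := mulr_ge0 (specnorm_ge0 H) (sqr_ge0 (enorm w)).
have [same|] := pselect (forall i, dsubmx x i 0 = 0 -> dsubmx (x + w) i 0 = 0).
  rewrite (@norm0_eq _ _ (dsubmx (x + w)) (dsubmx x)); last first.
    move=> i; apply/eqP/eqP; last exact: same.
    by move=> xwi; apply/eqP; apply: contraT => /supp; rewrite xwi eqxx.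
  rewrite gradx; last by move=> i xi; have := same i xi; rewrite linearD mxE xi add0r.
  lra.
move=> /existsNP[j /not_implyP[xj /eqP xwj]].
have := norm0_lt supp xj xwj; rewrite -(ler_pM2l lam0).
have := cauchy_schwarz (H *m x + l) w; rewrite ler_norml -/G => /andP[+ _].
by rewrite mulrDr; lra.
Qed.

End Subdifferential.

(* Proves linear identities between vectors, matrix products being atoms. *)
Local Ltac vec_ring :=
  repeat match goal with
  | |- context [@mulmx ?R ?p ?q ?r ?N ?v] =>
      let w := fresh "w" in move: (@mulmx R p q r N v) => w
  end;
  apply/matrixP => ? ?; rewrite !mxE; ring.

(** * The objectives as quadratics, and the minimization in [u] *)

Section Model.
Context {R : realType} {p n m : nat}.
Variables (A : 'M[R]_(p, n)) (b : 'cV[R]_p) (W : 'M[R]_(m, n)).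
Variables (lambda beta rho : R).
Let M := A^T *m A + beta *: (W^T *m W).
Let Z := pinv W^T.

Lemma trmx_hessian : M^T = M.
Proof. by rewrite /M linearD linearZ /= !trmx_gram. Qed.

Lemma lsq_qfun :
  lsq A b = qfun (A^T *m A) (- (A^T *m b)) (2^-1 * dotv b b).
Proof.
apply/funext => v; rewrite /lsq /qfun sqr_enorm -mulmxA dotv_trmxr.
by rewrite dotvNl dotv_trmxl !dotvE (dotvC _ b); lra.
Qed.

(** The gradient in [zmap] is that of a quadratic with Hessian [M], so the multiplier is affine in
    [v] and its pairing with [W *m u - y] in [hfun] is again quadratic. *)
Lemma zmapE v : zmap A b W beta v = - (Z *m M) *m v + Z *m (A^T *m b).
Proof.
rewrite /zmap lsq_qfun grad_qfun ?trmx_gram // -/Z.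
rewrite mulNmx -(mulmxA Z) [RHS]addrC -(mulmxBr Z); congr (_ *m _).
rewrite /M mulmxDl -scalemxAl.
by vec_ring.
Qed.

(** Hessian of the smooth part of [hfun] when the multiplier is [J *m u + z0]; [hlin z0] is the
    matching gradient at the origin. *)
Definition hhess (J : 'M[R]_(m, n)) : 'M[R]_(n + m) :=
  block_mx (M + W^T *m J + J^T *m W + rho *: (W^T *m W))
           (- (J^T + rho *: W^T))
           (- (J + rho *: W)) (rho%:M).

Definition hlin (z0 : 'cV[R]_m) : 'cV[R]_(n + m) :=
  col_mx (W^T *m z0 - A^T *m b) (- z0).

Lemma trmx_hhess J : (hhess J)^T = hhess J.
Proof.
have := trmx_hessian; rewrite /hhess; move: M => N NT.
rewrite tr_block_mx tr_scalar_mx; congr block_mx.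
- rewrite !linearD linearZ /= NT !trmx_mul !trmxK -!addrA.
  by congr (_ + _); rewrite addrCA.
- by rewrite linearN linearD linearZ /=.
- by rewrite linearN linearD linearZ /= !trmxK.
Qed.

Lemma hhess_col_mx J z0 v y : hhess J *m col_mx v y + hlin z0 =
  col_mx (M *m v - A^T *m b + W^T *m (J *m v + z0) + J^T *m (W *m v - y)
          + rho *: (W^T *m (W *m v - y)))
         (- (J *m v + z0) - rho *: (W *m v - y)).
Proof.
rewrite /hhess /hlin mul_block_col add_col_mx; congr col_mx.
- rewrite !(mulmxDl, mulNmx, mulmxN, mulmxDr) -!scalemxAl -!mulmxA.
  by vec_ring.
- rewrite !(mulmxDl, mulNmx) -scalemxAl mul_scalar_mx.
  by vec_ring.
Qed.

Lemma hpair_qfun J z0 : (forall v, zmap A b W beta v = J *m v + z0) ->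
  forall x, hpair A b W lambda beta rho x =
    qfun (hhess J) (hlin z0) (2^-1 * dotv b b) x + lambda * norm0 (dsubmx x).
Proof.
move=> zE x; rewrite -[x]vsubmxK /hpair col_mxKu col_mxKd.
move: (usubmx x) (dsubmx x) => {x} v y.
rewrite /hfun zE /qfun /hhess /hlin mul_block_col !dotv_col_mx lsq_qfun /qfun.
rewrite /M !(mulmxDl, mulNmx) -!scalemxAl !mul_scalar_mx -!mulmxA.
rewrite !sqr_enorm !dotvE !(dotv_trmxl, dotv_trmxr).
rewrite (dotvC (J *m v) (W *m v)) (dotvC y (J *m v)) (dotvC y (W *m v)).
rewrite (dotvC y z0) (dotvC (W *m v) z0).
by lra.
Qed.

Lemma u_objective_qfun tk uk yk zk :
  u_objective A b W beta rho tk uk yk zk =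
  qfun (M + tk%:M + rho *: (W^T *m W))
       (W^T *m zk - A^T *m b - tk *: uk - rho *: (W^T *m yk))
       (2^-1 * dotv b b - dotv yk zk + tk / 2 * dotv uk uk
        + rho / 2 * dotv yk yk).
Proof.
apply/funext => v; rewrite /u_objective lsq_qfun /qfun /M.
rewrite !(mulmxDl, mulNmx) -!scalemxAl !mul_scalar_mx -!mulmxA.
rewrite !sqr_enorm !dotvE !(dotv_trmxl, dotv_trmxr).
rewrite (dotvC v uk) (dotvC yk (W *m v)) (dotvC (W *m v) zk).
by lra.
Qed.

Lemma trmx_uhess tk :
  (M + tk%:M + rho *: (W^T *m W))^T = M + tk%:M + rho *: (W^T *m W).
Proof.
have := trmx_hessian; move: M => N NT.
by rewrite !linearD linearZ /= tr_scalar_mx trmx_gram NT.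
Qed.

Lemma u_step_stationary tk uk yk zk u1 :
  is_argmin (u_objective A b W beta rho tk uk yk zk) u1 ->
  M *m u1 - A^T *m b + W^T *m zk + tk *: (u1 - uk)
    + rho *: (W^T *m (W *m u1 - yk)) = 0.
Proof.
rewrite u_objective_qfun => /qfun_argmin <-; last first.
  exact: trmx_uhess.
rewrite !mulmxDl mul_scalar_mx -!scalemxAl -!mulmxA !(mulmxDr, mulmxN).
by vec_ring.
Qed.

(** Expanding exactly around the stationary point [u1] leaves half the Hessian form at [uk - u1];
    the [A] and [W] contributions are nonnegative, and the proximal term supplies the claimed
    decrease. *)
Lemma u_step_decrease tk uk yk zk u1 : 0 < beta -> 0 < rho ->
  is_argmin (u_objective A b W beta rho tk uk yk zk) u1 ->
  u_objective A b W beta rho tk uk yk zk u1 + tk / 2 * enorm (u1 - uk) ^+ 2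
    <= u_objective A b W beta rho tk uk yk zk uk.
Proof.
move=> beta0 rho0; rewrite u_objective_qfun => umin.
move: (qfun_argmin (trmx_uhess tk) umin) => stat.
rewrite -[X in _ <= qfun _ _ _ X](subrKC u1) (qfunD _ _ (trmx_uhess tk)) stat.
rewrite dot0v addr0 lerD2l enormBC sqr_enorm.
move: (uk - u1) => w; rewrite /M !mulmxDl -!scalemxAl mul_scalar_mx -!mulmxA.
rewrite !dotvE !dotv_trmxr.
have := dotv_ge0 (A *m w); have := mulr_ge0 (ltW beta0) (dotv_ge0 (W *m w)).
have := mulr_ge0 (ltW rho0) (dotv_ge0 (W *m w)).
by lra.
Qed.

End Model.

(** * Estimates for one iteration: thresholding, descent, gradient bound *)

Section Steps.
Context {R : realType} {p n m : nat}.
Variables (A : 'M[R]_(p, n)) (b : 'cV[R]_p) (W : 'M[R]_(m, n)).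
Variables (lambda beta rho : R).
Let M := A^T *m A + beta *: (W^T *m W).
Let Z := pinv W^T.

(** Models a perturbation of a nonzero entry [s0] that must avoid making it zero, since only then is
    the support count unchanged. *)
Lemma quadratic_min_off_point (g a s0 : R) : 0 < a -> s0 != 0 ->
  (forall s, s0 + s != 0 -> 0 <= s * g + a * s ^+ 2) -> g = 0.
Proof.
move=> a0 s00 gmin; apply/eqP; apply: contraT => g0.
have ga : g / a * a = g by rewrite divfK ?gt_eqF.
have gg : 0 < g ^+ 2 by rewrite exprn_even_gt0.
set w := g / a in ga.
have ww : 0 < a * w ^+ 2.
  rewrite mulr_gt0 // exprn_even_gt0 //=.
  by apply: contra_neq g0 => w0; rewrite -ga w0 mul0r.
(* The minimizer [- w / 2] gives a negative value if [g != 0]. If it is the excluded point,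
   [- w / 4] is admissible and still gives a negative value. *)
have [e|ne] := eqVneq (s0 - w / 2) 0.
  have /gmin : s0 - w / 4 != 0 by apply: contra_neq s00 => ?; lra.
  by rewrite -ga; lra.
by have := gmin _ ne; rewrite -ga; lra.
Qed.

Lemma y_objective_delta tk u1 yk z1 y1 i s :
  y_objective W lambda rho tk u1 yk z1 (y1 + s *: delta_mx i 0) =
  y_objective W lambda rho tk u1 yk z1 y1
  + lambda * (norm0 (y1 + s *: delta_mx i 0) - norm0 y1)
  + s * (- z1 i 0 + tk * (y1 i 0 - yk i 0) - rho * ((W *m u1) i 0 - y1 i 0))
  + (tk + rho) / 2 * s ^+ 2.
Proof.
rewrite /y_objective; move: (norm0 _) (norm0 _) (W *m u1) => N1 N2 v.
have ii : dotv (delta_mx i 0) (delta_mx i 0) = 1 :> R.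
  by rewrite dotv_delta mxE !eqxx.
rewrite !sqr_enorm !dotvE ii !(dotvC (delta_mx i 0)) !dotv_delta.
by field.
Qed.

(* Perturbing or deleting a single nonzero coordinate of a minimizer shows
   that the smooth part is stationary there and that the coordinate is large
   enough to pay for [lambda]. *)
Lemma y_step_coord tk u1 yk z1 y1 i : 0 < lambda -> 0 < tk -> 0 < rho ->
  is_argmin (y_objective W lambda rho tk u1 yk z1) y1 -> y1 i 0 != 0 ->
  - z1 i 0 + tk * (y1 i 0 - yk i 0) - rho * ((W *m u1) i 0 - y1 i 0) = 0 /\
  2 * lambda <= (tk + rho) * y1 i 0 ^+ 2.
Proof.
move=> lam0 tk0 rho0 ymin yi; have tr0 : 0 < (tk + rho) / 2.
  by rewrite divr_gt0 // addr_gt0.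
have coord s j :
    (y1 + s *: delta_mx i 0) j 0 = if j == i then y1 i 0 + s else y1 j 0.
  by rewrite !mxE eqxx andbT; case: eqP => [->|_]; rewrite ?mulr1 ?mulr0 ?addr0.
set g := - z1 i 0 + _ - _.
have g0 : g = 0.
  apply: (quadratic_min_off_point tr0 yi) => s ys.
  have := ymin (y1 + s *: delta_mx i 0); rewrite y_objective_delta -/g.
  rewrite (@norm0_eq _ _ _ y1); first by rewrite subrr; lra.
  move=> j; rewrite coord; case: (eqVneq j i) => // ->.
  by rewrite (negPf ys) (negPf yi).
split => //; have := ymin (y1 - y1 i 0 *: delta_mx i 0).
rewrite -scaleNr y_objective_delta -/g g0 sqrrN.
have supp j : (y1 + - y1 i 0 *: delta_mx i 0) j 0 != 0 -> y1 j 0 != 0.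
  by rewrite coord; case: (eqVneq j i) => [->|//]; rewrite subrr eqxx.
have := @norm0_lt _ _ (y1 + - y1 i 0 *: delta_mx i 0) y1 i supp.
rewrite coord eqxx subrr => /(_ erefl yi); rewrite -(ler_pM2l lam0) mulrDr mulrBr.
by lra.
Qed.

(** All summands are nonnegative; this one controls the change of multiplier in
    [one_step_descent]. *)
Lemma step_bound_lower :
  4 * ((specnorm M + 1) * specnorm (pinv W) ^+ 2 * specnorm M)
    <= step_bound A W beta.
Proof.
rewrite /step_bound ler_pM2l // lerDr addr_ge0 ?specnorm_ge0 //.
by rewrite !mulr_ge0 ?specnorm_ge0 ?exprn_ge0.
Qed.

Hypothesis hW : row_free W.

Lemma pinv_trmx_bound v : enorm (Z *m v) <= specnorm (pinv W) * enorm v.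
Proof. by rewrite /Z pinv_trmx; exact: enorm_trmx_mulmx. Qed.

Lemma zmap_diff u1 uk :
  zmap A b W beta u1 - zmap A b W beta uk = - (Z *m (M *m (u1 - uk))).
Proof. by rewrite !zmapE !mulmxBr !mulNmx !mulmxA; vec_ring. Qed.

(** Apply [Z] to the stationarity of the [u]-step, with [Z *m W^T = 1] by full row rank. The
    multiplier cancels the gradient at [uk], so only differences [u1 - uk] remain and the residual
    is of the order of the step. *)
Lemma residual tk uk yk u1 :
  is_argmin (u_objective A b W beta rho tk uk yk (zmap A b W beta uk)) u1 ->
  rho *: (W *m u1 - yk) =
  - (Z *m (M *m (u1 - uk)) + tk *: (Z *m (u1 - uk))).
Proof.
move=> /u_step_stationary stat.
have ZW v : Z *m (W^T *m v) = v by rewrite mulmxA pinv_trmx_mulmx // mul1mx.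
have := congr1 (mulmx Z) stat.
rewrite mulmx0 mulmxDr -scalemxAr ZW mulmxDr -scalemxAr mulmxDr ZW zmapE.
rewrite -/M -/Z mulNmx -mulmxA => stat0.
apply/eqP; rewrite -subr_eq0 -{}stat0; apply/eqP; rewrite !mulmxBr.
by vec_ring.
Qed.

(** The [u]-step gains [tk] times the squared [u]-increment, half from the proximal term and half
    from curvature; the [y]-step gains its proximal term. Between them the multiplier changes, which
    costs at most a quarter of the [u]-gain. *)
Lemma one_step_descent tk uk yk u1 y1 :
  0 < lambda -> 0 < beta -> 1 <= rho -> 0 < tk -> tk <= rho ->
  step_bound A W beta <= tk ->
  is_argmin (u_objective A b W beta rho tk uk yk (zmap A b W beta uk)) u1 ->
  is_argmin (y_objective W lambda rho tk u1 yk (zmap A b W beta u1)) y1 ->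
  hfun A b W lambda beta rho u1 y1
    + tk / 2 * enorm (col_mx u1 y1 - col_mx uk yk) ^+ 2
  <= hfun A b W lambda beta rho uk yk.
Proof.
move=> lam0 beta0 rho1 tk0 tkrho sb umin ymin.
have rho0 : 0 < rho by lra.
have Udec := u_step_decrease beta0 rho0 umin.
have Ydec := ymin yk.
(* After multiplication by [rho], both factors are bounded by the [u]-increment through [residual]
   and [zmap_diff]. The conditions [tk <= rho] and [1 <= rho] give [mu + tk <= rho * (mu + 1)],
   which lets [step_bound] absorb the product. *)
have cross : dotv (W *m u1 - yk) (zmap A b W beta u1 - zmap A b W beta uk)
    <= tk / 4 * enorm (u1 - uk) ^+ 2.
  rewrite zmap_diff -(ler_pM2l rho0) -dotvZl (residual umin).
  rewrite dotvNl dotvNr opprK.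
  set w := specnorm (pinv W); set mu := specnorm M; set e := enorm (u1 - uk).
  have w0 : 0 <= w by exact: specnorm_ge0.
  have mu0 : 0 <= mu by exact: specnorm_ge0.
  have e0 : 0 <= e by exact: enorm_ge0.
  have ZM : enorm (Z *m (M *m (u1 - uk))) <= w * (mu * e).
    by apply: le_trans (pinv_trmx_bound _) _; rewrite ler_wpM2l // enorm_mulmx.
  have ZD : enorm (tk *: (Z *m (u1 - uk))) <= tk * (w * e).
    by rewrite enormZ gtr0_norm // ler_pM2l // pinv_trmx_bound.
  apply: le_trans (dotv_le _ _) _.
  apply: (@le_trans _ _ ((w * (mu * e) + tk * (w * e)) * (w * (mu * e)))).
    apply: ler_pM => //; rewrite ?enorm_ge0 //.
    by apply: le_trans (enormD _ _) _; exact: lerD.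
  have sb' := le_trans step_bound_lower sb; rewrite -/w -/mu in sb'.
  apply: (@le_trans _ _ (rho * ((mu + 1) * w ^+ 2 * mu) * e ^+ 2)).
    have -> : (w * (mu * e) + tk * (w * e)) * (w * (mu * e))
      = (mu + tk) * (w ^+ 2 * mu) * e ^+ 2 by ring.
    rewrite ler_wpM2r ?sqr_ge0 //.
    have K0 : 0 <= w ^+ 2 * mu by rewrite mulr_ge0 ?exprn_ge0.
    have /(ler_wpM2r K0) : mu + tk <= rho * (mu + 1) by nra.
    by lra.
  by have /(ler_wpM2l (ltW rho0)) := ler_wpM2r (sqr_ge0 e) sb'; lra.
rewrite opp_col_mx add_col_mx sqr_enorm dotv_col_mx -!sqr_enorm.
move: Udec Ydec cross; rewrite /u_objective /y_objective /hfun.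
rewrite !subrr !enorm0 expr0n /= !mulr0.
have := mulr_ge0 (ltW tk0) (sqr_ge0 (enorm (u1 - uk))).
rewrite !dotvE; move: (zmap _ _ _ _ u1) (zmap _ _ _ _ uk) => z1 z0.
by lra.
Qed.

(** Orthogonal projection onto the pairs whose second component is supported in the support of
    [y]. *)
Definition maskmx (y : 'cV[R]_m) : 'M[R]_(n + m) :=
  block_mx 1%:M 0 0 (diag_mx (\row_i (y i 0 != 0)%:R)).

Lemma maskmx_col_mx y v w :
  maskmx y *m col_mx v w = col_mx v (\col_i ((y i 0 != 0)%:R * w i 0)).
Proof.
rewrite /maskmx mul_block_col !mul0mx mul1mx addr0 add0r mul_diag_mx.
by congr col_mx; apply/colP => i; rewrite !mxE.
Qed.

Lemma trmx_maskmx y : (maskmx y)^T = maskmx y.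
Proof. by rewrite /maskmx tr_block_mx tr_diag_mx !trmx0 trmx1. Qed.

Lemma maskmx_id y v : maskmx y *m col_mx v y = col_mx v y.
Proof.
rewrite maskmx_col_mx; congr col_mx; apply/colP => i; rewrite mxE.
by case: eqP => [->|]; rewrite ?mulr0 ?mul1r.
Qed.

Lemma maskmx_eq (y y' : 'cV[R]_m) : (forall i, (y i 0 == 0) = (y' i 0 == 0)) ->
  maskmx y = maskmx y'.
Proof.
move=> yy'; rewrite /maskmx; congr (block_mx _ _ _ (diag_mx _)).
by apply/rowP => i; rewrite !mxE yy'.
Qed.

Definition zlinear := - (Z *m M).
Definition zconst := Z *m (A^T *m b).
Let H := hhess A W beta rho zlinear.
Let l := hlin A b W zconst.

(** The error bound needed for linear convergence, with [B] independent of the iteration.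
    Subtracting the stationarity of the [u]-step leaves only increments in the first block; on the
    support, stationarity of the [y]-step makes the second block exactly [- tk *: dy]. *)
Lemma masked_gradient_bound (tmax : R) y : exists B, forall tk uk yk u1 y1,
  0 < lambda -> 0 < beta -> 1 <= rho -> 0 < tk -> tk <= tmax ->
  maskmx y1 = maskmx y ->
  is_argmin (u_objective A b W beta rho tk uk yk (zmap A b W beta uk)) u1 ->
  is_argmin (y_objective W lambda rho tk u1 yk (zmap A b W beta u1)) y1 ->
  enorm (maskmx y *m (H *m col_mx u1 y1 + l))
    <= B * enorm (col_mx u1 y1 - col_mx uk yk).
Proof.
pose J := zlinear.
exists (specnorm (W^T *m J) + tmax + rho * specnorm W^T
  + specnorm J^T * (specnorm J + tmax * specnorm Z + 1) + tmax).
move=> tk uk yk u1 y1 lam0 beta0 rho1 tk0 tkmax <- umin ymin.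
have rho0 : 0 < rho by lra.
rewrite opp_col_mx add_col_mx; set du := u1 - uk; set dy := y1 - yk.
set e := enorm (col_mx du dy).
have e0 : 0 <= e by exact: enorm_ge0.
have du_e : enorm du <= e by exact: enorm_col_mxl.
have dy_e : enorm dy <= e by exact: enorm_col_mxr.
have zE v : zmap A b W beta v = J *m v + zconst by rewrite zmapE.
rewrite /H /l hhess_col_mx -/J -zE maskmx_col_mx.
apply: le_trans (enorm_col_mx_le _ _) _; rewrite mulrDl; apply: lerD.
- set r := W *m u1 - yk.
  have rE : rho *: r = J *m du - tk *: (Z *m du).
    by rewrite /r (residual umin) opprD /J mulNmx mulmxA.
  have r_e : enorm r <= (specnorm J + tmax * specnorm Z) * e.
    (* Since [1 <= rho], the residual is no larger than its multiple by [rho], which [residual]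
       expresses through [du]. *)
    apply: (@le_trans _ _ (enorm (rho *: r))).
      by rewrite enormZ gtr0_norm // ler_peMl ?enorm_ge0.
    rewrite rE mulrDl; apply: le_trans (enormB _ _) _; apply: lerD.
      by apply: le_trans (enorm_mulmx _ _) _; rewrite ler_wpM2l ?specnorm_ge0.
    rewrite enormZ gtr0_norm // -mulrA; apply: ler_pM => //.
    - exact: ltW.
    - exact: enorm_ge0.
    - by apply: le_trans (enorm_mulmx _ _) _; rewrite ler_wpM2l ?specnorm_ge0.
  have -> : M *m u1 - A^T *m b + W^T *m zmap A b W beta u1
      + J^T *m (W *m u1 - y1) + rho *: (W^T *m (W *m u1 - y1))
    = W^T *m J *m du - tk *: du - rho *: (W^T *m dy) + J^T *m (r - dy).
    have -> : W *m u1 - y1 = r - dy by rewrite /r /dy; vec_ring.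
    have -> : W^T *m J *m du
        = W^T *m zmap A b W beta u1 - W^T *m zmap A b W beta uk.
      by rewrite -mulmxA -mulmxBr zmap_diff /J mulNmx !mulmxA.
    apply/eqP; rewrite -subr_eq0 -(u_step_stationary umin) -/M -/du -/r.
    rewrite !(mulmxBr _ r).
    by apply/eqP; vec_ring.
  rewrite !mulrDl; apply: le_trans (enormD _ _) _; apply: lerD; last first.
    rewrite -mulrA; apply: le_trans (enorm_mulmx _ _) _.
    rewrite ler_wpM2l ?specnorm_ge0 //; apply: le_trans (enormB _ _) _.
    by rewrite mulrDl mul1r lerD.
  apply: le_trans (enormB _ _) _; apply: lerD; last first.
    rewrite enormZ gtr0_norm // -mulrA ler_pM2l //.
    by apply: le_trans (enorm_mulmx _ _) _; rewrite ler_wpM2l ?specnorm_ge0.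
  apply: le_trans (enormB _ _) _; apply: lerD.
    by apply: le_trans (enorm_mulmx _ _) _; rewrite ler_wpM2l ?specnorm_ge0.
  by rewrite enormZ gtr0_norm // ler_pM ?enorm_ge0 // ltW.
- apply: (@le_trans _ _ (enorm (tk *: dy))); last first.
    by rewrite enormZ gtr0_norm // ler_pM ?enorm_ge0 // ltW.
  rewrite -ler_sqr ?nnegrE ?enorm_ge0 // !sqr_enorm; apply: ler_sum => i _.
  rewrite !mxE -!expr2; case: eqP => [_|/eqP yi].
    by rewrite mul0r expr0n sqr_ge0.
  have [stat _] := y_step_coord lam0 tk0 rho0 ymin yi.
  move: stat; rewrite mul1r !mxE => stat.
  rewrite le_eqVlt; apply/orP; left; apply/eqP.
  rewrite -[RHS]sqrrN; congr (_ ^+ 2).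
  by lra.
Qed.

End Steps.

(** * Geometric tails, restriction to a subspace, and the final assembly *)

Section Tail.
Context {R : realType}.

(** The first [K] terms are covered by enlarging the constant. The rate is raised to at least 1/2 so
    that one may divide by its [K]-th power even when [tau = 0]. *)
Lemma geometric_tail (e : nat -> R) (B c1 tau : R) (K : nat) :
  0 <= B -> 0 <= c1 -> 0 <= tau -> tau < 1 ->
  (forall k, e k <= B) -> (forall k, e (K + k)%N <= c1 * tau ^+ k) ->
  exists c2 sigma, [/\ 0 < c2, 0 <= sigma, sigma < 1 &
    forall k, e k <= c2 * sigma ^+ k].
Proof.
move=> B0 c10 tau0 tau1 eB etau; pose s := Num.max tau 2^-1.
have s1 : s < 1 by rewrite gt_max tau1 /=; lra.
have s0 : 0 < s by rewrite lt_max; apply/orP; right; lra.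
have sK : 0 < s ^+ K by rewrite exprn_gt0.
exists ((B + c1 + 1) / s ^+ K), s; split=> //.
- by rewrite divr_gt0 //; lra.
- exact: ltW.
move=> k; rewrite mulrAC ler_pdivlMr //.
have [Kk|/ltnW kK] := leqP K k; last first.
  apply: (@le_trans _ _ (B * s ^+ K)); first by rewrite ler_wpM2r ?eB // ltW.
  apply: ler_pM => //; [exact: ltW|lra|].
  by rewrite ler_wiXn2l // ltW.
have -> : s ^+ k = s ^+ (k - K) * s ^+ K by rewrite -exprD subnK.
rewrite mulrA ler_wpM2r ?(ltW sK) //.
have := etau (k - K)%N; rewrite subnKC // => /le_trans; apply.
apply: ler_pM => //; [exact: exprn_ge0|lra|].
by rewrite lerXn2r ?nnegrE ?(ltW s0) // le_max lexx.
Qed.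

(** Used with [D] a support projection: the compressed quadratic agrees with the original on the
    range of [D], and its gradient there is [D] applied to the original gradient. *)
Lemma qfun_restrict d (D H : 'M[R]_d) l c x : D^T = D -> D *m x = x ->
  qfun (D *m H *m D) (D *m l) c x = qfun H l c x.
Proof.
move=> DT Dx; rewrite /qfun -!mulmxA Dx dotv_mulmxr DT Dx.
by rewrite dotv_mulmxl DT Dx.
Qed.

End Tail.

Theorem theorem3p11 (R : realType) (p n m : nat)
    (A : 'M[R]_(p, n)) (b : 'cV[R]_p) (W : 'M[R]_(m, n))
    (lambda beta rho c tmax : R) (t : nat -> R)
    (u : nat -> 'cV[R]_n) (y z : nat -> 'cV[R]_m)
    (hlambda : 0 < lambda) (hbeta : 0 < beta) (hrho : 0 < rho)
    (ht : forall k, 0 < t k)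
    (hW : row_free W)
    (halg : algorithmA A b W lambda beta rho t u y z)
    (hbdd : exists B : R, forall k, enorm (col_mx (u k) (y k)) <= B)
    (htmax_ub : forall k, t k <= tmax)
    (htmax_att : exists k, t k = tmax)
    (hrho_ge : Num.max tmax 1 <= rho)
    (hc : 0 < c)
    (ht_ge : forall k, Num.max (step_bound A W beta) c <= t k) :
  exists (us : 'cV[R]_n) (ys : 'cV[R]_m),
    limiting_critical (hpair A b W lambda beta rho) (col_mx us ys) /\
    exists c1 tau : R,
      [/\ 0 < c1, 0 <= tau, tau < 1 &
          forall k, enorm (col_mx (u k) (y k) - col_mx us ys)
                    <= c1 * tau ^+ k].
Proof.
have [lam0 [beta0 rho0]] := conj hlambda (conj hbeta hrho).
have [y00 z0E step] := halg.
have zE k : z k = zmap A b W beta (u k).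
  by case: k => [//|k]; have [_ -> _] := step k.
have [tmax_rho rho1] : tmax <= rho /\ 1 <= rho.
  by move: hrho_ge; rewrite ge_max => /andP[].
have t_rho k : t k <= rho := le_trans (htmax_ub k) tmax_rho.
have [t_sb t_c] : (forall k, step_bound A W beta <= t k) /\ forall k, c <= t k.
  by split=> k; have := ht_ge k; rewrite ge_max => /andP[].
pose x k := col_mx (u k) (y k); pose h := hpair A b W lambda beta rho.
have hE : forall v, h v = _ + lambda * norm0 (dsubmx v) :=
  hpair_qfun lambda rho (zmapE A b W beta).
set H := hhess _ _ _ _ _ in hE; set l := hlin _ _ _ _ in hE.
set cst := _ * dotv b b in hE.
have Hsym : H^T = H := trmx_hhess _ _ _ _ _.
have descent k : h (x k.+1) + c / 2 * enorm (x k.+1 - x k) ^+ 2 <= h (x k).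
  have [umin _ ymin] := step k; rewrite !zE in umin ymin.
  have := one_step_descent hW lam0 beta0 rho1 (ht k) (t_rho k) (t_sb k)
    umin ymin.
  rewrite /h /hpair !col_mxKu !col_mxKd; apply: le_trans; rewrite lerD2l.
  by rewrite ler_wpM2r ?sqr_ge0 // ler_pM2r.
have steps_vanish e : 0 < e ->
    exists N, forall k, (N <= k)%N -> enorm (x k.+1 - x k) <= e.
  move=> e0; have [B xB] := hbdd; have [C Cle] := qfun_bounded H l cst B.
  have hlb k : - C <= h (x k).
    rewrite hE; apply: le_trans (Cle _ (xB k)) _.
    by rewrite lerDl mulr_ge0 ?norm0_ge0 // ltW.
  have hdec k : h (x k.+1) <= h (x k).
    apply: le_trans (descent k); rewrite lerDl mulr_ge0 ?sqr_ge0 //.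
    by rewrite divr_ge0 // ltW.
  have [|N NP] := decrements_vanish hdec hlb (e := c / 2 * e ^+ 2).
    by rewrite mulr_gt0 ?divr_gt0 ?exprn_gt0.
  exists N => k /NP small; rewrite -ler_sqr ?nnegrE ?enorm_ge0 ?(ltW e0) //.
  have c2 : 0 < c / 2 by rewrite divr_gt0.
  by rewrite -(ler_pM2l c2); have := descent k; lra.
(* A nonzero entry has square at least [2 * lambda / (t k + rho)], hence at least [lambda / rho]
   because [t k <= rho]. *)
pose gap := Num.sqrt (lambda / rho).
have gap0 : 0 < gap by rewrite sqrtr_gt0 divr_gt0.
have y_gap k i : y k.+1 i 0 != 0 -> gap <= `|y k.+1 i 0|.
  move=> yi; have [_ _ ymin] := step k.
  have [_] := y_step_coord lam0 (ht k) rho0 ymin yi.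
  rewrite -(ler_sqr (x := gap)) ?nnegrE ?(ltW gap0) //.
  rewrite real_normK ?num_real // sqr_sqrtr ?divr_ge0 ?(ltW lam0) ?(ltW rho0) //.
  rewrite ler_pdivrMr //; have := ler_wpM2r (sqr_ge0 (y k.+1 i 0)) (t_rho k).
  lra.
have [N NP] := steps_vanish (gap / 2) (divr_gt0 gap0 (ltr0n _ 2)).
(* A successor, since [y_gap] concerns only iterates produced by a [y]-step and not [y 0]. *)
pose K := N.+1.
(* An entry entering or leaving the support would jump by at least [gap], but steps are now at most
   [gap / 2]. *)
have suppS k i : (y (K + k).+1 i 0 == 0) = (y (K + k)%N i 0 == 0).
  have : `|y (K + k).+1 i 0 - y (K + k)%N i 0| <= gap / 2.
    apply: le_trans (NP (K + k)%N _); last by rewrite addSn leqW // leq_addr.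
    have := ler_coord_enorm (x (K + k).+1 - x (K + k)%N) (rshift n i).
    by rewrite /x opp_col_mx add_col_mx col_mxEd 2!mxE.
  case: eqP => [->|/eqP/y_gap]; case: eqP => [->|/eqP yi] //.
    by rewrite sub0r normrN; have := y_gap _ _ yi; lra.
  by rewrite subr0; lra.
have supp k i : (y (K + k)%N i 0 == 0) = (y K i 0 == 0).
  by elim: k => [|k IH]; rewrite ?addn0 // addnS suppS.
pose D : 'M[R]_(n + m) := maskmx (y K).
have maskE k : maskmx (y (K + k)%N) = D by apply: maskmx_eq => i; exact: supp.
have DT : D^T = D := trmx_maskmx _.
have Dx k : D *m x (K + k)%N = x (K + k)%N by rewrite -(maskE k) maskmx_id.
pose xt k := x (K + k)%N.
have [B gradB] := masked_gradient_bound A b lambda beta rho hW tmax (y K).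
(* Once the support is frozen the counting term is constant, so the descent of [h] is a descent of
   the compressed quadratic. *)
have [|||||xs [c1 [tau [crit c10 tau0 tau1 xslim]]]] :=
  @descent_linear_convergence R _ (D *m H *m D) (D *m l) cst (c / 2) B xt.
- by rewrite !trmx_mul DT Hsym mulmxA.
- by rewrite divr_gt0.
- move=> k; rewrite !qfun_restrict ?Dx // /xt addnS.
  have := descent (K + k)%N; rewrite !hE /x !col_mxKd.
  rewrite (@norm0_eq _ _ (y (K + k).+1) (y (K + k)%N)) //.
  by lra.
- move=> k; rewrite -!mulmxA Dx -mulmxDr /xt addnS.
  have [umin _ ymin] := step (K + k)%N; rewrite !zE in umin ymin.
  apply: gradB umin ymin => //.
  by rewrite -addnS maskE.
- move=> e e0; have [N' N'P] := steps_vanish e e0; exists N' => k N'k.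
  by rewrite /xt addnS N'P // (leq_trans N'k) // leq_addl.
(* The range of [D] is closed: the limit is taken in the equation [(D - 1) *m x = 0]. *)
have Dxs : D *m xs = xs.
  apply/eqP; rewrite -subr_eq0 -{2}[xs]mul1mx -mulmxBl -[_ *m xs]addr0; apply/eqP.
  apply: (mulmx_eq0_geometric_limit (ltW c10) tau0 tau1 xslim) => k.
  rewrite mulmxBl mul1mx Dx subrr addr0 enorm0.
  by rewrite mulr_ge0 ?exprn_ge0 // ltW.
have gradxs : D *m (H *m xs + l) = 0 by rewrite mulmxDr -{1}Dxs !mulmxA.
exists (usubmx xs), (dsubmx xs); rewrite vsubmxK; split.
  apply: (limiting_critical_qfun_norm0 Hsym lam0 hE) => w w0.
  suff Dw : D *m w = w by rewrite -Dw dotv_mulmxr DT gradxs dot0v.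
  rewrite -[w]vsubmxK maskmx_col_mx; congr col_mx; apply/colP => i; rewrite mxE.
  case: eqP => [yi|]; last by rewrite mul1r.
  rewrite mul0r w0 // -Dxs -[xs]vsubmxK maskmx_col_mx col_mxKd mxE yi eqxx.
  by rewrite mul0r.
have [B' xB'] := hbdd.
apply: (@geometric_tail _ _ (`|B'| + enorm xs) c1 tau K) => //.
- by rewrite addr_ge0 ?enorm_ge0.
- exact: ltW.
- move=> k; apply: le_trans (enormB _ _) _; rewrite lerD2r.
  exact: le_trans (xB' k) (ler_norm _).
Qed.
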